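(* Let $k\ge 3$ and $a_1,\dots,a_k\in\mathbb{Z}\setminus\{0\}$, with at least one $a_i$ positive and at least one negative. Then there exists $\delta>0$ such that for all sufficiently large $n$, every 2-coloring of $[n]$ has at least $\delta n^{k-1}$ monochromatic solutions to $a_1x_1+\dots+a_kx_k=0$, i.e. at least $\delta n^{k-1}$ tuples $(x_1,\dots,x_k)\in[n]^k$ satisfying the equation whose entries all receive the same color.
   Context: $[n]=\{1,\dots,n\}$. *)

(* Defs.v *)
From mathcomp Require Import all_boot all_order all_algebra.
From mathcomp Require Import reals.

Set Implicit Arguments.
Unset Strict Implicit.
Unset Printing Implicit Defensive.

Import GRing.Theory.
Local Open Scope ring_scope.

(* The set [n] = {1, ..., n} is represented by 'I_n = {0, ..., n - 1}: the
   ordinal i stands for the integer i + 1. *)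
Definition elt (n : nat) (i : 'I_n) : int := (i.+1)%:Z.

Definition is_solution (k n : nat) (a : 'I_k -> int) (x : {ffun 'I_k -> 'I_n}) :
  bool := \sum_(i < k) a i * elt (x i) == 0.

Definition monochromatic (k n : nat) (c : 'I_n -> bool)
    (x : {ffun 'I_k -> 'I_n}) : bool :=
  [forall i, forall j, c (x i) == c (x j)].

Definition mono_solutions (k n : nat) (a : 'I_k -> int) (c : 'I_n -> bool) :
  {set {ffun 'I_k -> 'I_n}} :=
  [set x | is_solution a x && monochromatic c x].

(* Main.v *)
Require Import Defs.
From mathcomp Require Import all_boot all_order all_algebra.
From mathcomp Require Import reals zify ring.

(** The key observation is an exchange argument.  Fix an index [i0].  Suppose that
    for every [l != i0] there are a red number [u l] and a blue number [u' l] with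
    [u l - u' l = e l * theta], where [theta] does not depend on [l] and
    [\sum_(l != i0) a l * e l = 0].  Then the red tuple [u] and the blue tuple [u']
    are completed to a solution by the same number [x i0], so one of the two
    completions is monochromatic, whatever the colour of [x i0].

    Such pairs are found as follows.  Take a grid of solutions, in which moving
    along one grid direction keeps [x i1 - x l] fixed up to a scaling factor.  If no
    solution of the grid is monochromatic, then by pigeonhole, on some grid line [x i1]
    and [x l0] have opposite colours, red and blue in the same order, for more than
    [k] solutions.  Cut each of these parallel segments into equal steps of length
    [e l * theta]: some step goes from one colour to the other.  The scaling
    factors grow so fast that the entry given to index [i2] dominates, which makes
    the completing entry [x i0] positive.

    To get [n ^ (k - 1)] solutions rather than one, every point of the configuration
    depends on integer parameters ranging over [0, m], with [m] proportional to [n],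
    and each of the possible monochromatic solutions determines [k - 1] of the
    parameters in terms of the other ones. *)

Set Implicit Arguments.
Unset Strict Implicit.
Unset Printing Implicit Defensive.

Import Order.TTheory GRing.Theory Num.Theory.
Local Open Scope ring_scope.

(** * Counting and pigeonhole lemmas *)

(** Sending [w] to its label, its solution and the copy of [w] with private coordinates reset to [0]
    is injective. Each label and solution allow only [m.+1 ^ (#|I| - d)] such copies. *)
Lemma card_le_of_private_coordinates (I L X : finType) (m d : nat)
    (pi : L -> {set I}) (rel : {ffun I -> 'I_m.+1} -> L -> X -> Prop) (S : {set X}) :
  (forall w lam x, rel w lam x -> #|pi lam| = d) ->
  (forall w, exists lam, exists2 x, x \in S & rel w lam x) ->
  (forall w w' lam x, rel w lam x -> rel w' lam x ->
     (forall i, i \notin pi lam -> w i = w' i) -> w = w') ->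
  (m.+1 ^ d <= #|L| * #|S|)%N.
Proof.
move=> card_pi ex_rel inj_rel.
have /fin_all_exists [lam /fin_all_exists2 [x xS rel_x]] := ex_rel.
pose reset w := [ffun i => if i \in pi (lam w) then ord0 else w i].
pose D := [set t : L * X * {ffun I -> 'I_m.+1} |
   ((t.1.2 \in S) && (#|pi t.1.1| == d)) &&
   (t.2 \in pffun_on ord0 (mem (~: pi t.1.1)) predT)].
have inj_t : injective (fun w => (lam w, x w, reset w)).
  move=> w w' [eq_lam eq_x /ffunP eq_r].
  apply: (inj_rel w w' (lam w) (x w)) => //.
    by rewrite eq_lam eq_x.
  move=> i ni; have := eq_r i; rewrite !ffunE -eq_lam.
  by rewrite (negbTE ni).
have sub_D : [set (lam w, x w, reset w) | w in [set: {ffun I -> 'I_m.+1}]] \subset D.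
  apply/subsetP => _ /imsetP[w _ ->]; rewrite inE /= xS (card_pi _ _ _ (rel_x w)) eqxx /=.
  apply/pffun_onP; split; last by move=> y _.
  apply/subsetP => i; rewrite !inE ffunE.
  by case: ifP => //; rewrite eqxx.
have le_d : (d <= #|I|)%N.
  by rewrite -(card_pi _ _ _ (rel_x [ffun=> ord0])) max_card.
rewrite -(leq_pmul2r (_ : 0 < m.+1 ^ (#|I| - d))%N) ?expn_gt0 // -expnD subnKC //.
have := subset_leq_card sub_D; rewrite card_imset // cardsT card_ffun card_ord.
move=> le_D; apply: (leq_trans le_D).
rewrite -sum1_card (eq_bigl (fun t : L * X * {ffun I -> 'I_m.+1} =>
   ((t.1.2 \in S) && (#|pi t.1.1| == d)) &&
   (t.2 \in pffun_on ord0 (mem (~: pi t.1.1)) predT))); last by move=> t; rewrite inE.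
rewrite -(pair_big_dep (fun t : L * X => (t.2 \in S) && (#|pi t.1| == d))
   (fun t (w : {ffun I -> 'I_m.+1}) => w \in pffun_on ord0 (mem (~: pi t.1)) predT)
   (fun _ _ => 1%N)) /=.
rewrite (eq_bigr (fun=> (m.+1 ^ (#|I| - d))%N)); last first.
  move=> t /andP[_ /eqP <-]; rewrite sum1_card card_pffun_on.
  have -> : #|mem (~: pi t.1)| = (#|I| - #|pi t.1|)%N by rewrite [LHS]cardsCs setCK.
  by congr (_ ^ _)%N; rewrite -[RHS]card_ord; apply: eq_card.
apply: (@leq_trans (\sum_(t : L * X | t.2 \in S) m.+1 ^ (#|I| - d))%N).
  rewrite big_mkcondr leq_sum // => t _; by case: ifP.
rewrite -(pair_big (fun _ : L => true) (mem S) (fun _ _ => (m.+1 ^ (#|I| - d))%N)) /=.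
by rewrite !sum_nat_const mulnA.
Qed.

(** Otherwise each type would occur at most [T * r] times, too few to fill the [T * T] grid. Types
    are counted separately, so each may use its own line direction. *)
Lemma grid_line_with_repeated_type (T r : nat) (F : finType) (ty : 'I_T -> 'I_T -> F)
    (dir : F -> bool) :
  (#|F| * r < T)%N ->
  exists f, exists v : 'I_T,
    (r < #|[set t | (if dir f then ty t v else ty v t) == f]|)%N.
Proof.
move=> ltT.
case: (pickP (fun fv : F * 'I_T => (r < #|[set t |
    (if dir fv.1 then ty t fv.2 else ty fv.2 t) == fv.1]|)%N)) => [[f v] /= ?|no_f].
  by exists f, v.
suff : (T * T <= T * (#|F| * r))%N by rewrite leq_mul2l leqNgt ltT orbF; lia.
have -> : (T * T = \sum_(f : F) \sum_(v < T) \sum_(t < T)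
    ((if dir f then ty t v else ty v t) == f))%N.
  rewrite (eq_bigr (fun f => \sum_(v < T) \sum_(t < T) (ty v t == f))%N); last first.
    by move=> f _; case: (dir f) => //; rewrite exchange_big.
  rewrite exchange_big /= (eq_bigr (fun=> T)) ?sum_nat_const ?card_ord // => v _.
  rewrite exchange_big /= (eq_bigr (fun=> 1%N)) ?sum_nat_const ?card_ord ?muln1 // => t _.
  by rewrite (bigD1 (ty v t)) //= eqxx big1 ?addn0 // => f /negbTE; rewrite eq_sym => ->.
rewrite mulnCA -sum_nat_const leq_sum // => f _.
have -> : (T * r = \sum_(v < T) r)%N by rewrite sum_nat_const card_ord.
rewrite leq_sum // => v _.
have /negbT := no_f (f, v); rewrite -leqNgt; apply: leq_trans.
by rewrite -sum1_card [X in (_ <= X)%N]big_mkcond leq_sum // => t _; rewrite inE; case: eqP.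
Qed.

Lemma adjacent_switch (col : int -> bool) (g : nat -> int) (n : nat) (r : bool) :
  col (g 0%N) = r -> col (g n) = ~~ r ->
  exists2 s, (s < n)%N & col (g s) = r /\ col (g s.+1) = ~~ r.
Proof.
elim: n => [|n IHn] g0; first by rewrite g0; case: (r).
move=> gn; case: (boolP (col (g n) == r)) => [/eqP gr|gr]; first by exists n.
have [||s ltsn gs] := IHn; first by [].
  by move: gr; case: (col _); case: (r).
by exists s => //; rewrite ltnS ltnW.
Qed.

(** The index [i] takes the maximum of [S]; the strict inequality leaves [k] smaller elements for
    the others. *)
Lemma injection_with_top (T k : nat) (S : {set 'I_T}) (i : 'I_k) : (k < #|S|)%N ->
  exists f : 'I_k -> 'I_T, [/\ injective f, forall l, f l \in S &
    forall l, l != i -> (f l < f i)%N].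
Proof.
move=> ltkS.
have /card_gt0P [t0 t0S] : (0 < #|S|)%N by apply: leq_ltn_trans ltkS.
have [t tS tmax] := @arg_maxnP _ t0 (mem S) (fun t : 'I_T => t : nat) t0S.
have leS : (k <= #|S :\ t|)%N by move: ltkS; rewrite (cardsD1 t S) (_ : t \in S).
pose g l := enum_val (widen_ord leS l).
have gP l : g l \in S :\ t by apply: enum_valP.
have g_lt l : (g l < t)%N.
  have := gP l; rewrite in_setD1 => /andP[neq /tmax /= le].
  by rewrite ltn_neqAle neq le.
exists (fun l => if l == i then t else g l); split.
- move=> l l'; case: eqP => [->|_]; case: eqP => [->|_] //.
  + by move=> e; have := g_lt l'; rewrite -e ltnn.
  + by move=> e; have := g_lt l; rewrite e ltnn.
  + by move=> /enum_val_inj /(congr1 val) /= /val_inj.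
- by move=> l; case: eqP => // _; have := gP l; rewrite in_setD1 => /andP[].
- by move=> l /negbTE ->; rewrite eqxx.
Qed.

(** * Explicit solutions and completion of tuples *)

Section Weights.
Variables (k : nat) (a : 'I_k -> int).

Definition pos_weight (P : pred 'I_k) : nat := \sum_(j | P j && (0 < a j)) `|a j|.
Definition neg_weight (P : pred 'I_k) : nat := \sum_(j | P j && ~~ (0 < a j)) `|a j|.
(** Each sign class receives the total of the opposite class, so the two halves of the weighted sum
    cancel. With [P] the complement of [i0], these are the coefficients [e l] of the exchange
    argument. *)
Definition weight P l : nat := if 0 < a l then neg_weight P else pos_weight P.
Definition coweight P l : nat := if 0 < a l then pos_weight P else neg_weight P.
Definition abs_sum : nat := \sum_j `|a j|.

Lemma weight_mul P l : (weight P l * coweight P l = pos_weight P * neg_weight P)%N.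
Proof. by rewrite /weight /coweight; case: ifP => // _; rewrite mulnC. Qed.

Lemma sum_weight P : \sum_(l | P l) a l * (weight P l)%:Z = 0.
Proof.
rewrite (bigID (fun l => 0 < a l)) /=.
rewrite (eq_bigr (fun l => (`|a l|%N)%:Z * (neg_weight P)%:Z)); last first.
  by move=> l /andP[_ al]; rewrite /weight al abszE gtr0_norm.
rewrite [X in _ + X](eq_bigr (fun l => - ((`|a l|%N)%:Z * (pos_weight P)%:Z))); last first.
  move=> l /andP[_ al]; rewrite /weight (negbTE al) abszE ler0_norm ?mulNr ?opprK //.
  by rewrite leNgt.
rewrite sumrN -!mulr_suml -!(big_morph Posz PoszD (erefl 0%:Z)).
by rewrite [X in _ - X]mulrC subrr.
Qed.

Lemma weight_gt0 (P : pred 'I_k) i j l : P i -> P j -> 0 < a i -> a j < 0 ->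
  (0 < weight P l)%N /\ (0 < coweight P l)%N.
Proof.
move=> Pi Pj ai aj.
have p0 : (0 < pos_weight P)%N.
  by rewrite /pos_weight (bigD1 i) ?Pi ?ai //= addn_gt0; lia.
have n0 : (0 < neg_weight P)%N.
  by rewrite /neg_weight (bigD1 j) ?Pj ?addn_gt0 /=; lia.
by rewrite /weight /coweight; case: ifP.
Qed.

Lemma abs_sum_restrict (P : pred 'I_k) : (\sum_(j | P j) `|a j| <= abs_sum)%N.
Proof. by rewrite big_mkcond leq_sum // => j _; case: ifP. Qed.

Lemma weight_le P l : (weight P l <= abs_sum)%N /\ (coweight P l <= abs_sum)%N.
Proof. by rewrite /weight /coweight; case: ifP; split; apply: abs_sum_restrict. Qed.

Lemma norm_lincomb_le (P : pred 'I_k) (x : 'I_k -> int) (N : nat) :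
  (forall j, P j -> `|x j| <= N%:Z) ->
  `|\sum_(j | P j) a j * x j| <= (abs_sum * N)%N%:Z.
Proof.
move=> xN; apply: le_trans (ler_norm_sum _ _ _) _.
apply: (@le_trans _ _ ((\sum_(j | P j) `|a j|)%N * N)%N%:Z); last first.
  by rewrite lez_nat leq_mul2r abs_sum_restrict orbT.
rewrite PoszM (big_morph Posz PoszD (erefl 0%:Z)) mulr_suml ler_sum // => j Pj.
by rewrite normrM abszE ler_wpM2l ?xN.
Qed.

(** The factor [a i0] on the other entries keeps the completing entry integral. *)
Definition complete (i0 : 'I_k) (w : 'I_k -> int) (l : 'I_k) : int :=
  if l == i0 then - \sum_(j | j != i0) a j * w j else a i0 * w l.

Lemma complete_solution i0 w : \sum_l a l * complete i0 w l = 0.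
Proof.
rewrite (bigD1 i0) //= {1}/complete eqxx mulrN mulr_sumr.
rewrite [X in _ + X](eq_bigr (fun j => a i0 * (a j * w j))) ?addNr // => j ji0.
by rewrite /complete (negbTE ji0) mulrCA.
Qed.

Lemma norm_complete_le i0 w (N : nat) l :
  (forall j, j != i0 -> `|w j| <= N%:Z) -> `|complete i0 w l| <= (abs_sum * N)%N%:Z.
Proof.
move=> wN; rewrite /complete; case: eqP => [_|/eqP li0].
  by rewrite normrN norm_lincomb_le.
rewrite normrM PoszM; apply: ler_pM => //; last exact: wN.
by have := abs_sum_restrict (pred1 i0); rewrite big_pred1_eq; lia.
Qed.

End Weights.

(** * Constants and grid directions *)

Section Configuration.

Variables (k : nat) (a : 'I_k -> int) (i0 i1 i2 : 'I_k).
Hypotheses (a0 : 0 < a i0) (a1 : 0 < a i1) (a2 : a i2 < 0) (i1_neq_i0 : i1 != i0).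

Let alpha := abs_sum a.
Let P := predC1 i0.
Definition weight_product : nat := (pos_weight a P * neg_weight a P)%N.
Local Notation E := weight_product.

(** There are [k * 2] types (an index and a colour), and one must occur more than [k] times on a
    line. *)
Definition grid_size : nat := (k * 2 * k).+1.
Let T := grid_size.
(* Makes the base term of [pos] dominate its three perturbations. *)
Definition base_ratio : nat := (3 * alpha ^ 2).+1.
Let B := base_ratio.
Definition spread : nat := ((B + 3 * alpha) * alpha)%N.
Let C1 := spread.
(** Exceeds [alpha * C1], so that one entry a scale higher outweighs the combination of all the
    others. *)
Definition scale_ratio : nat := (alpha * C1).+1.
Let K := scale_ratio.

Lemma i2_neq_i0 : i2 != i0.
Proof. by apply/eqP => e; move: a2; rewrite e; lia. Qed.

Lemma i2_neq_i1 : i2 != i1.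
Proof. by apply/eqP => e; move: a2; rewrite e; lia. Qed.

(* The values at [i1] and [i2] are chosen so that [shift false] agrees at [i0] and [i1]. *)
Definition direction (b : bool) (j : 'I_k) : int :=
  if b then 1 else if j == i1 then a i2 else if j == i2 then - (a i1 + a i0) else 0.

Definition shift (b : bool) (l : 'I_k) : int := complete a i0 (direction b) l.

Lemma shift_i1_neq0 b : shift b i1 != 0.
Proof.
rewrite /shift /complete (negbTE i1_neq_i0) /direction eqxx mulf_neq0 //; first by lia.
by case: b => //; lia.
Qed.

(** Hence moving in direction [l != i0] leaves the difference of the entries at [l] and [i1]
    unchanged. *)
Lemma shift_agree l : shift (l != i0) l = shift (l != i0) i1.
Proof.
rewrite /shift /complete (negbTE i1_neq_i0); case: eqP => [_|_] //=.
rewrite (bigD1 i1) ?i1_neq_i0 //= (bigD1 i2) /=; last by rewrite i2_neq_i0 i2_neq_i1.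
rewrite big1 => [|j /andP[/andP[j0 j1] j2]]; last first.
  by rewrite (negbTE j1) (negbTE j2) mulr0.
by rewrite eqxx (negbTE i2_neq_i1) eqxx; ring.
Qed.

Lemma norm_coef_le l : `|a l| <= alpha%:Z.
Proof.
have := abs_sum_restrict a (pred1 l); rewrite big_pred1_eq; rewrite -/alpha; lia.
Qed.

Lemma abs_sum_gt0 : (0 < alpha)%N.
Proof. by have := norm_coef_le i0; lia. Qed.

Lemma norm_shift_le b l : `|shift b l| <= (alpha ^ 2)%N%:Z.
Proof.
rewrite expnS expn1; apply: norm_complete_le => j _; rewrite /direction.
have := abs_sum_gt0; case: b; first by lia.
have := norm_coef_le i2; case: ifP => // _; case: ifP => _; last by lia.
have := abs_sum_restrict a (pred2 i0 i1).
rewrite (bigD1 i0) /= ?eqxx // (bigD1 i1) /= ?eqxx ?orbT ?i1_neq_i0 //.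
by rewrite -/alpha; lia.
Qed.

(** * The parametrised grid, its segments and their monochromatic points *)

Section Family.

Variable m : nat.
Let M := m.+1.
Implicit Type w : {ffun 'I_k + bool * 'I_T -> 'I_m.+1}.

(** A large positive solution, perturbed by the [inl] parameters and shifted by one [inr] parameter
    per grid coordinate: [t] acts in direction [b], [v] in direction [~~ b]. *)
Definition pos w (b : bool) (t v : 'I_T) (l : 'I_k) : int :=
  (B * M * weight a predT l)%N%:Z + complete a i0 (fun j => (w (inl j))%:Z) l
  + shift b l * (w (inr (b, t)))%:Z + shift (~~ b) l * (w (inr (~~ b, v)))%:Z.

Lemma pos_sym w b t v l : pos w (~~ b) v t l = pos w b t v l.
Proof. by rewrite /pos negbK addrAC. Qed.

Lemma pos_solution w b t v : \sum_l a l * pos w b t v l = 0.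
Proof.
under eq_bigr do rewrite /pos 3!mulrDr PoszM.
rewrite 3!big_split /=.
have scaled c u : \sum_l a l * u l = 0 -> \sum_l a l * (u l * c) = 0.
  by move=> u0; under eq_bigr do rewrite mulrA; rewrite -mulr_suml u0 mul0r.
under eq_bigr do rewrite [(B * M)%N%:Z * _]mulrC.
by rewrite !scaled ?complete_solution ?sum_weight ?addr0.
Qed.

Lemma pos_bounds w b t v l :
  M%:Z <= pos w b t v l /\ pos w b t v l <= (C1 * M)%N%:Z.
Proof.
have [[wt0 _] [wt_le _]] : (0 < weight a predT l /\ 0 < coweight a predT l)%N /\
   (weight a predT l <= alpha /\ coweight a predT l <= alpha)%N.
  by split; [apply: (@weight_gt0 _ _ _ i0 i2) | apply: weight_le].
have wM i : `|(w i)%:Z| <= M%:Z by have := ltn_ord (w i); lia.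
have s_le c i : `|shift c l * (w i)%:Z| <= (alpha ^ 2 * M)%N%:Z.
  by rewrite normrM PoszM ler_pM ?norm_shift_le.
have c_le : `|complete a i0 (fun j => (w (inl j))%:Z) l| <= (alpha * M)%N%:Z.
  by apply: norm_complete_le => j _.
have := s_le b (inr (b, t)); have := s_le (~~ b) (inr (~~ b, v)); rewrite /pos.
have := abs_sum_gt0.
move: c_le {s_le}; set x := complete _ _ _ _; set y := _ * _; set z := _ * _.
move=> xle al0 zle yle.
have le1 : (B * M <= B * M * weight a predT l)%N by rewrite leq_pmulr.
have le2 : (B * M * weight a predT l <= B * M * alpha)%N by rewrite leq_mul2l wt_le orbT.
have le3 : (alpha * M <= alpha ^ 2 * M)%N by rewrite leq_mul2r; nia.
move: le1 le2 xle zle yle; set u := (B * M * _)%N.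
have -> : (B * M = 3 * (alpha ^ 2 * M) + M)%N by rewrite /B /base_ratio; ring.
have -> : (C1 * M = B * M * alpha + 3 * (alpha ^ 2 * M))%N by rewrite /C1 /spread -/B; ring.
have -> : (B * M * alpha = (3 * (alpha ^ 2 * M) + M) * alpha)%N by rewrite /B /base_ratio; ring.
by move: le3; set p := (alpha ^ 2 * M)%N; set q := (_ * alpha)%N; lia.
Qed.

(** The weight makes each step [weight P l] times the difference of the two entries, while
    [coweight] times weight is [E], so the end values depend on [l] only through the position
    [t]. *)
Definition seg w (l0 : 'I_k) (v t : 'I_T) (l : 'I_k) (s : nat) : int :=
  (weight a P l)%:Z *
  (((coweight a P l * K ^ (t + v))%N%:Z - s%:Z) * pos w (l0 != i0) t v i1
   + s%:Z * pos w (l0 != i0) t v l0).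

Lemma seg_bounds w l0 (v t : 'I_T) l s : (s <= coweight a P l * K ^ (t + v))%N ->
  (E * K ^ (t + v) * M)%N%:Z <= seg w l0 v t l s /\
  seg w l0 v t l s <= (E * K ^ (t + v) * (C1 * M))%N%:Z.
Proof.
move=> s_le; rewrite /seg.
have [x_ge x_le] := pos_bounds w (l0 != i0) t v i1.
have [y_ge y_le] := pos_bounds w (l0 != i0) t v l0.
have EE N : (E * K ^ (t + v) * N)%N%:Z =
    (weight a P l)%:Z * (coweight a P l * K ^ (t + v) * N)%N%:Z.
  by rewrite /E -(weight_mul a P l) -PoszM !mulnA.
rewrite !EE.
move: s_le; set n := (_ * K ^ _)%N; set q := weight a P l => s_le.
by split; apply: ler_wpM2l => //; rewrite PoszM; nia.
Qed.

Definition step_bound : nat := (alpha * K ^ (T + T)).+1.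
Let S := step_bound.

(* A label names a tuple of the configuration: [inl (t, v)] is the solution at the
   grid point [(t, v)]; in [inr (l0, v, f, s)] the index [l != i0] receives the
   [s l]-th subdivision point of the segment from [x i1] to [x l0] at position
   [f l] of the grid line [v]. *)
Definition label : finType :=
  ('I_T * 'I_T + 'I_k * 'I_T * {ffun 'I_k -> 'I_T} * {ffun 'I_k -> 'I_S})%type.

Definition point w (lab : label) : 'I_k -> int :=
  match lab with
  | inl (t, v) => fun l => (`|a i0| * E * K ^ (t + v))%N%:Z * pos w true t v l
  | inr (l0, v, f, s) => complete a i0 (fun j => seg w l0 v (f j) j (s j))
  end.

Definition valid (lab : label) : Prop :=
  match lab with
  | inl _ => True
  | inr (l0, v, f, s) =>
    [/\ injective f, forall l, (s l <= coweight a P l * K ^ (f l + v))%N &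
        forall l, l != i2 -> (f l < f i2)%N]
  end.

(** The parameters recovered from the tuple: base perturbations for a grid point, shifts at the
    distinct positions [f l] for a segment tuple. *)
Definition private (lab : label) : {set 'I_k + bool * 'I_T} :=
  match lab with
  | inl _ => [set inl l | l in [set~ i0]]
  | inr (l0, v, f, s) => [set inr (l0 != i0, f l) | l in [set~ i0]]
  end.

Lemma card_private lab : valid lab -> #|private lab| = k.-1.
Proof.
case: lab => [?|[[[l0 v] f] s]] /= => [_|[f_inj _ _]].
  by rewrite card_imset ?cardsC1 ?card_ord // => x y [].
by rewrite card_imset ?cardsC1 ?card_ord // => x y [] /f_inj.
Qed.

Definition range_bound : nat := (alpha * (`|a i0| * E * K ^ (T + T) * C1))%N.

Lemma weight_product_gt0 : (0 < E)%N.
Proof.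
rewrite /E -(weight_mul a P i0) muln_gt0.
by case: (@weight_gt0 _ a P i1 i2 i0 i1_neq_i0 i2_neq_i0 a1 a2) => -> ->.
Qed.

Lemma scale_pow_gt0 n : (0 < K ^ n)%N.
Proof. by rewrite expn_gt0. Qed.

Lemma point_solution w lab : \sum_l a l * point w lab l = 0.
Proof.
case: lab => [[t v]|[[[l0 v] f] s]] /=; last exact: complete_solution.
under eq_bigr do rewrite mulrCA.
by rewrite -mulr_sumr pos_solution mulr0.
Qed.

Lemma scale_pow_le (t v : 'I_T) : (K ^ (t + v) <= K ^ (T + T))%N.
Proof. by rewrite leq_pexp2l // leq_add // ltnW. Qed.

Lemma point_bounds w lab l : valid lab ->
  0 < point w lab l /\ point w lab l <= (range_bound * M)%N%:Z.
Proof.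
have al0 := abs_sum_gt0; have E0 := weight_product_gt0.
case: lab => [[t v] _|[[[l0 v] f] s] [_ s_le f_lt]] /=.
  have [ge le] := pos_bounds w true t v l.
  have c0 : (0 < `|a i0| * E * K ^ (t + v))%N by rewrite 2!muln_gt0 scale_pow_gt0 E0; lia.
  have c_le : (`|a i0| * E * K ^ (t + v) <= `|a i0| * E * K ^ (T + T))%N.
    by rewrite leq_mul2l scale_pow_le orbT.
  split; first by rewrite mulr_gt0 //; lia.
  apply: (@le_trans _ _ ((`|a i0| * E * K ^ (T + T))%N%:Z * (C1 * M)%N%:Z)).
    by apply: ler_pM => //; lia.
  rewrite -PoszM lez_nat mulnA leq_mul2r /range_bound.
  by rewrite leq_pmull ?orbT.
have sb j := seg_bounds w l0 (s_le j).
have K_lt j : j != i2 -> (K ^ (f j + v) * K <= K ^ (f i2 + v))%N.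
  by move=> /f_lt ji2; rewrite -expnSr leq_pexp2l // ltn_add2r.
have seg_abs j : `|seg w l0 v (f j) j (s j)| <= (E * K ^ (T + T) * (C1 * M))%N%:Z.
  have [ge le] := sb j; rewrite ger0_norm; last by apply: le_trans ge.
  apply: (le_trans le); by rewrite lez_nat leq_mul2r leq_mul2l scale_pow_le !orbT.
split; last first.
  have := @norm_complete_le _ a i0 _ _ l (fun j _ => seg_abs j).
  rewrite -/alpha; set x := complete _ _ _ _; set y := (_ * _)%N.
  suff : (y <= range_bound * M)%N by lia.
  rewrite /y /range_bound; have : (0 < `|a i0|)%N by lia.
  by move=> q0; rewrite -!mulnA leq_mul2l; apply/orP; right; rewrite leq_pmull.
rewrite /complete; case: eqP => [_|/eqP li0]; last first.
  rewrite mulr_gt0 //; have [ge _] := sb l; apply: lt_le_trans ge.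
  by rewrite ltz_nat 2!muln_gt0 E0 scale_pow_gt0.
rewrite (bigD1 i2) ?i2_neq_i0 //= opprD.
have small : `|\sum_(j < k | (j != i0) && (j != i2)) a j * seg w l0 v (f j) j (s j)|
     < (E * K ^ (f i2 + v) * M)%N%:Z.
  (* Every other position is below [f i2], which gains a factor [K]; [alpha * C1 < K] then makes the
     remaining sum smaller than the [i2] entry. *)
  pose N := ((E * K ^ (f i2 + v) * M) %/ K * C1)%N.
  apply: le_lt_trans (@norm_lincomb_le _ _ _ _ N _) _.
    move=> j /andP[_ /K_lt jlt]; have [ge le] := sb j.
    rewrite ger0_norm; last by apply: le_trans ge.
    apply: (le_trans le); rewrite lez_nat /N mulnCA mulnC leq_pmul2r; last first.
      by rewrite muln_gt0 abs_sum_gt0 addn_gt0.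
    rewrite leq_divRL // mulnAC leq_pmul2r // -mulnA leq_pmul2l //; exact: jlt.
  rewrite -/alpha ltz_nat /N; have := leq_divM (E * K ^ (f i2 + v) * M) K.
  have : (0 < E * K ^ (f i2 + v) * M)%N by rewrite 2!muln_gt0 E0 scale_pow_gt0.
  set x := (E * _ * _)%N; set y := (x %/ K)%N => x0 le_x.
  case: (posnP y) => [->|y0]; first by rewrite mul0n muln0.
  by apply: leq_trans le_x; rewrite /K /scale_ratio; nia.
have [ge _] := sb i2; move: small ge; set x := \sum_(_ < _ | _) _.
set y := seg _ _ _ _ _ _; set z := (E * _ * _)%N; nia.
Qed.

(** On a segment, both ends contain the private shift with the same coefficient, by [shift_agree].
    Every subdivision point therefore contains it with a nonzero coefficient independent of [s]. *)
Lemma point_inj w w' lab : valid lab ->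
  (forall l, l != i0 -> point w lab l = point w' lab l) ->
  (forall i, i \notin private lab -> w i = w' i) -> w = w'.
Proof.
have a0n : a i0 != 0 by lia.
have E0 := weight_product_gt0.
case: lab => [[t v] _|[[[l0 v] f] s] [f_inj s_le f_lt]] /= eq_pt eq_off.
  apply/ffunP => i; case: (boolP (i \in [set inl l | l in [set~ i0]])) => [|/eq_off //].
  case/imsetP => l; rewrite in_setC1 => li0 -> {i}.
  have eq_r u : w (inr u) = w' (inr u).
    by apply: eq_off; apply/imsetP => -[].
  have c0 : (`|a i0| * E * K ^ (t + v))%N%:Z != 0.
    by rewrite eqz_nat -lt0n 2!muln_gt0 scale_pow_gt0 E0; lia.
  move: (eq_pt l li0) => /(mulfI c0); rewrite /pos /complete (negbTE li0) !eq_r.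
  by move=> /addIr /addIr /addrI /(mulfI a0n) [] /val_inj.
set b := l0 != i0 in eq_off *.
apply/ffunP => i; case: (boolP (i \in [set inr (b, f l) | l in [set~ i0]])) => [|/eq_off //].
case/imsetP => l; rewrite in_setC1 => li0 -> {i}.
have eq_l u : w (inl u) = w' (inl u).
  by apply: eq_off; apply/imsetP => -[].
have eq_b u : w (inr (~~ b, u)) = w' (inr (~~ b, u)).
  by apply: eq_off; apply/imsetP => -[? _ [+ _]]; case: (b).
have eq_c l' : complete a i0 (fun j => (w (inl j))%:Z) l' =
    complete a i0 (fun j => (w' (inl j))%:Z) l'.
  by rewrite /complete !eq_l; under eq_bigr do rewrite eq_l.
have shift_l0 : shift b l0 = shift b i1 := shift_agree l0.
have wt0 := @weight_gt0 _ a P i1 i2 l i1_neq_i0 i2_neq_i0 a1 a2.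
move: (eq_pt l li0); rewrite /complete (negbTE li0) => /(mulfI a0n).
have w0 : (weight a P l)%:Z != 0 by lia.
rewrite /seg => /(mulfI w0); rewrite -/b /pos !eq_c !eq_b shift_l0.
set n := (_ * K ^ _)%N.
set x := (w _)%:Z; set y := (w' (inr (b, f l)))%:Z => eq_xy.
have : n%:Z * shift b i1 * x = n%:Z * shift b i1 * y.
  apply/eqP; rewrite -subr_eq0; apply/eqP.
  by move/eqP: eq_xy; rewrite -subr_eq0 => /eqP <-; ring.
have n0 : n%:Z * shift b i1 != 0.
  by rewrite mulf_neq0 ?shift_i1_neq0 // eqz_nat -lt0n muln_gt0 scale_pow_gt0; lia.
by move=> /(mulfI n0) [] /val_inj.
Qed.

Lemma seg_0 w l0 (v t : 'I_T) l : a i0 * seg w l0 v t l 0 =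
  (`|a i0| * E * K ^ (t + v))%N%:Z * pos w (l0 != i0) t v i1.
Proof.
rewrite /seg subr0 mul0r addr0 /E -(weight_mul a P l) !PoszM.
by rewrite abszE gtr0_norm // !mulrA.
Qed.

Lemma seg_last w l0 (v t : 'I_T) l : a i0 * seg w l0 v t l (coweight a P l * K ^ (t + v)) =
  (`|a i0| * E * K ^ (t + v))%N%:Z * pos w (l0 != i0) t v l0.
Proof.
rewrite /seg subrr mul0r add0r /E -(weight_mul a P l) !PoszM.
by rewrite abszE gtr0_norm // !mulrA.
Qed.

Lemma complete_seg_succ w l0 v (f : 'I_k -> 'I_T) (s : 'I_k -> nat) :
  complete a i0 (fun j => seg w l0 v (f j) j (s j).+1) i0 =
  complete a i0 (fun j => seg w l0 v (f j) j (s j)) i0.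
Proof.
rewrite /complete eqxx; congr (- _); apply/eqP; rewrite -subr_eq0 -sumrB; apply/eqP.
set b := l0 != i0.
have shift_l0 : shift b l0 = shift b i1 := shift_agree l0.
(* The difference of the entries at [l0] and [i1]: the shifts depending on [f j] cancel, so one [th]
   serves all [j]. *)
pose th := (B * M * weight a predT l0)%N%:Z + complete a i0 (fun j => (w (inl j))%:Z) l0
  + shift (~~ b) l0 * (w (inr (~~ b, v)))%:Z
  - ((B * M * weight a predT i1)%N%:Z + complete a i0 (fun j => (w (inl j))%:Z) i1
  + shift (~~ b) i1 * (w (inr (~~ b, v)))%:Z).
rewrite (eq_bigr (fun j => th * (a j * (weight a P j)%:Z))); last first.
  move=> j _; rewrite /seg -/b /pos shift_l0 /th intS; ring.
by rewrite -mulr_sumr sum_weight mulr0.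
Qed.

Lemma monochromatic_point (col : int -> bool) w : exists2 lab, valid lab &
  forall l, col (point w lab l) = col (point w lab i0).
Proof.
pose val (t v : 'I_T) l := (`|a i0| * E * K ^ (t + v))%N%:Z * pos w true t v l.
case: (pickP (fun tv : 'I_T * 'I_T =>
   [forall l, col (val tv.1 tv.2 l) == col (val tv.1 tv.2 i1)])) => [[t v] /forallP eq_col|no_tv].
  by exists (inl (t, v)) => // l /=; rewrite (eqP (eq_col l)) (eqP (eq_col i0)).
have /fin_all_exists [ty ty_neq] : forall tv : 'I_T * 'I_T, exists l,
    col (val tv.1 tv.2 l) != col (val tv.1 tv.2 i1).
  by move=> tv; have /negbT/forallPn := no_tv tv.
(* A type records an index coloured unlike [i1] together with the colour at [i1]; its line direction
   is the one of [shift_agree]. *)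
have [] := @grid_line_with_repeated_type T k ('I_k * bool)%type
  (fun t v => (ty (t, v), col (val t v i1))) (fun f => f.1 != i0).
  by rewrite card_prod card_ord card_bool.
move=> [l0 r] [v]; set A := [set t | _] => big_A.
have A_col t : t \in A ->
    col ((`|a i0| * E * K ^ (t + v))%N%:Z * pos w (l0 != i0) t v i1) = r /\
    col ((`|a i0| * E * K ^ (t + v))%N%:Z * pos w (l0 != i0) t v l0) = ~~ r.
  rewrite inE; case: ifP => /= b0 /eqP[ty_l <-].
    have := ty_neq (t, v); rewrite ty_l /= /val.
    by case: (col _); case: (col _).
  have := ty_neq (v, t); rewrite ty_l /= /val -!(pos_sym w true) /= addnC.
  by case: (col _); case: (col _).
have [f [f_inj fA f_lt]] := injection_with_top i2 big_A.
have /fin_all_exists2 [s s_lt s_col] : forall l, exists2 s,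
    (s < coweight a P l * K ^ (f l + v))%N &
    col (a i0 * seg w l0 v (f l) l s) = r /\ col (a i0 * seg w l0 v (f l) l s.+1) = ~~ r.
  move=> l; have [c0 c1] := A_col _ (fA l).
  by apply: (adjacent_switch (g := fun s => a i0 * seg w l0 v (f l) l s));
    rewrite ?seg_0 ?seg_last.
have s_S l : ((s l).+1 < S)%N.
  rewrite ltnS; apply: leq_trans (s_lt l) _; apply: leq_mul; last exact: scale_pow_le.
  by case: (weight_le a P l).
pose s' (d : bool) := [ffun l => inord (s l + d) : 'I_S].
have s'E d l : s' d l = (s l + d)%N :> nat.
  by rewrite ffunE inordK //; apply: leq_ltn_trans (s_S l); rewrite -addn1 leq_add2l leq_b1.
(* If the completing entry has colour [r], the lower ends of the steps are used, otherwise the upper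
   ends; [complete_seg_succ] keeps that entry the same. *)
pose d := col (complete a i0 (fun j => seg w l0 v (f j) j (s j)) i0) != r.
exists (inr (l0, v, finfun f, s' d)) => [|l] /=.
  split=> [x y|l|l li2]; rewrite ?s'E !ffunE; [exact: f_inj | | exact: f_lt].
  by apply: leq_trans (s_lt l); rewrite -addn1 leq_add2l leq_b1.
have eq_z : complete a i0 (fun j => seg w l0 v (finfun f j) j (s' d j)) i0 =
    complete a i0 (fun j => seg w l0 v (f j) j (s j)) i0.
  case: (d).
    rewrite -[RHS]complete_seg_succ /complete eqxx; congr (- _).
    by apply: eq_bigr => j _; rewrite s'E ffunE addn1.
  rewrite /complete eqxx; congr (- _).
  by apply: eq_bigr => j _; rewrite s'E ffunE addn0.
case: (eqVneq l i0) => [->|li0] //.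
rewrite eq_z {1}/complete (negbTE li0) s'E ffunE.
have [c0 c1] := s_col l; rewrite /d; case: eqP => [->|/eqP] /=; first by rewrite addn0.
by rewrite addn1 c1; case: (col _); case: (r).
Qed.

End Family.

End Configuration.

(** * Counting the monochromatic solutions *)

Lemma mono_solutions_lower_bound (k : nat) (a : 'I_k -> int) (i0 i1 i2 : 'I_k) :
  0 < a i0 -> 0 < a i1 -> a i2 < 0 -> i1 != i0 ->
  exists C L : nat, forall (m n : nat) (c : 'I_n -> bool), (C * m.+1 <= n)%N ->
    (m.+1 ^ k.-1 <= L * #|mono_solutions a c|)%N.
Proof.
move=> a0 a1 a2 i1_neq_i0; exists (range_bound a i0).+1, #|label a| => m [|n] c le_n.
  by move: le_n; rewrite mulnS.
pose rel (w : {ffun 'I_k + bool * 'I_(grid_size k) -> 'I_m.+1}) (lab : label a)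
    (x : {ffun 'I_k -> 'I_n.+1}) :=
  valid i0 i2 lab /\ forall l, elt (x l) = point i0 i1 i2 w lab l.
apply: (card_le_of_private_coordinates (pi := @private _ a i0) (rel := rel)).
- by move=> w lab x [val_lab _]; apply: card_private val_lab.
(* The predecessor undoes the offset in [elt]; [point_bounds] keeps all points used within the range
   of [inord]. *)
- move=> w; pose pt (x : int) : 'I_n.+1 := inord (`|x|%N).-1.
  have [lab val_lab mono] := monochromatic_point a0 a1 a2 i1_neq_i0 (fun x => c (pt x)) w.
  have elt_pt l : elt (pt (point i0 i1 i2 w lab l)) = point i0 i1 i2 w lab l.
    have [gt0 le] := point_bounds a0 a1 a2 i1_neq_i0 w l val_lab.
    by rewrite /elt /pt inordK; nia.
  exists lab, [ffun l => pt (point i0 i1 i2 w lab l)]; last first.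
    by split=> // l; rewrite ffunE.
  rewrite inE; apply/andP; split.
    apply/eqP; rewrite -[RHS](point_solution i0 i1 i2 w lab).
    by apply: eq_bigr => l _; rewrite ffunE elt_pt.
  by apply/forallP => l; apply/forallP => j; rewrite !ffunE (mono l) (mono j).
- move=> w w' lab x [val_lab x_w] [_ x_w'].
  by apply: (point_inj a0 a1 a2 i1_neq_i0 val_lab) => l _; rewrite -x_w -x_w'.
Qed.

Lemma mono_solutions_opp (k n : nat) (a : 'I_k -> int) (c : 'I_n -> bool) :
  mono_solutions (fun i => - a i) c = mono_solutions a c.
Proof.
apply/setP => x; rewrite !inE /is_solution.
by under eq_bigr do rewrite mulNr; rewrite sumrN oppr_eq0.
Qed.

Theorem theorem1p2 (R : realType) (k : nat) (a : 'I_k -> int)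
    (hk : (3 <= k)%N)
    (ha : forall i, a i != 0)
    (hpos : exists i, 0 < a i)
    (hneg : exists i, a i < 0) :
  exists2 delta : R, 0 < delta &
    exists N : nat, forall n : nat, (N <= n)%N ->
      forall c : 'I_n -> bool,
        delta * n%:R ^+ (k - 1) <= #|mono_solutions a c|%:R.
Proof.
case: hpos hneg => [i ai] [j aj].
(* The sign of a third coefficient yields two of one sign and one of the other; negating the
   equation if necessary makes the two positive. *)
have [l] : exists l, l \notin [set i; j].
  apply/existsP; rewrite -negb_forall; apply/negP => /forallP all_ij.
  have : ([set: 'I_k] \subset [set i; j]) by apply/subsetP => l _; apply: all_ij.
  move/subset_leq_card; rewrite cardsT card_ord cards2; case: (_ != _); lia.
rewrite !inE negb_or => /andP[li lj].
have [C [L count]] : exists C L : nat, forall (m n : nat) (c : 'I_n -> bool),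
    (C * m.+1 <= n)%N -> (m.+1 ^ k.-1 <= L * #|mono_solutions a c|)%N.
  case: (ltrgt0P (a l)) (ha l) => // al _.
    exact: (mono_solutions_lower_bound ai al aj li).
  have [|||C [L count]] :=
    @mono_solutions_lower_bound _ (fun i => - a i) j l i _ _ _ lj; rewrite ?oppr_gt0 ?oppr_lt0 //.
  by exists C, L => m n c le_n; rewrite -(mono_solutions_opp a c); exact: count.
(* With [m.+1] the quotient of [n] by [C.+1], one has [n <= 2 * C.+1 * m.+1]; [L.+1] instead of [L]
   keeps [D] positive. *)
pose D := (L.+1 * (2 * C.+1) ^ k.-1)%N.
have D0 : 0 < D%:R :> R by rewrite ltr0n muln_gt0 expn_gt0.
exists D%:R^-1; first by rewrite invr_gt0.
exists C.+1 => n leCn c; rewrite mulrC ler_pdivrMr // subn1 -natrX -natrM ler_nat.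
have := divn_eq n C.+1; have := ltn_pmod n (ltn0Sn C).
have : (0 < n %/ C.+1)%N by rewrite divn_gt0.
case: (n %/ C.+1)%N => // m _ ltC eq_n.
have leCm : (C * m.+1 <= n)%N by nia.
have n_le : (n <= 2 * C.+1 * m.+1)%N by nia.
apply: (@leq_trans ((2 * C.+1) ^ k.-1 * m.+1 ^ k.-1)%N).
  by rewrite -expnMn leq_exp2r //; lia.
have := count m n c leCm; rewrite /D; move: (m.+1 ^ _)%N => x le_x.
rewrite mulnA [X in (_ <= X)%N]mulnC leq_mul2l; apply/orP; right.
by apply: (leq_trans le_x); rewrite mulnS mulnC leq_addl.
Qed.
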